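(* Let $H$ be a finite dimensional Hopf algebra over an algebraically closed field $\mathbb{K}$ of characteristic zero, with comultiplication $\Delta$ and counit $\varepsilon$, and let $D:H\to H$ be an automorphism of Hopf algebras of finite order $m$. Let $r\in\mathbb{K}$ be an element of multiplicative order $2m$ if $m$ is even and of multiplicative order $m$ if $m$ is odd, and let $q=r^2$. Let $\mathcal{E}=\{0\le i\le m-1: q^i\in\operatorname{Spec}(D)\}$ and, for $i\in\mathcal{E}$, $E_{D,q^i}=\{x\in H: Dx=q^ix\}$. For each $i\in\mathcal{E}$ take an arbitrary direct sum decomposition into subspaces $E_{D,q^i}=V_{+,i}\oplus V_{-,i}$, and define the linear transformation $\sigma$ on $H$ by $\sigma|_{V_{\pm,i}}=\pm r^i\operatorname{id}$ for all $i\in\mathcal{E}$. Assume that all the following conditions hold: (A1) $1\in V_{+,0}$; (A2) for all $i,j\in\mathcal{E}$ with $0\le i+j\le m-1$: $V_{+,i}V_{+,j}+V_{-,i}V_{-,j}\subseteq V_{+,i+j}$ and $V_{+,i}V_{-,j}+V_{-,i}V_{+,j}\subseteq V_{-,i+j}$; (A3) for all $i,j\in\mathcal{E}$ with $m\le i+j\le 2m-2$: if $m$ is even, $V_{+,i}V_{+,j}+V_{-,i}V_{-,j}\subseteq V_{-,i+j-m}$ and $V_{+,i}V_{-,j}+V_{-,i}V_{+,j}\subseteq V_{+,i+j-m}$; if $m$ is odd, $V_{+,i}V_{+,j}+V_{-,i}V_{-,j}\subseteq V_{+,i+j-m}$ and $V_{+,i}V_{-,j}+V_{-,i}V_{+,j}\subseteq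 V_{-,i+j-m}$; (C1) $\varepsilon(V_{-,0})=0$; (C2) for all $i\in\mathcal{E}$, writing $P_{a,b}=V_{+,a}\otimes V_{+,b}+V_{-,a}\otimes V_{-,b}$ and $N_{a,b}=V_{+,a}\otimes V_{-,b}+V_{-,a}\otimes V_{+,b}$ for $a,b\in\mathcal{E}$: if $m$ is even, $$\Delta(V_{+,i})\subseteq\bigoplus_{a+b=i}P_{a,b}\oplus\bigoplus_{a+b=i+m}N_{a,b},\qquad \Delta(V_{-,i})\subseteq\bigoplus_{a+b=i}N_{a,b}\oplus\bigoplus_{a+b=i+m}P_{a,b};$$ if $m$ is odd, $$\Delta(V_{+,i})\subseteq\bigoplus_{a+b=i}P_{a,b}\oplus\bigoplus_{a+b=i+m}P_{a,b},\qquad \Delta(V_{-,i})\subseteq\bigoplus_{a+b=i}N_{a,b}\oplus\bigoplus_{a+b=i+m}N_{a,b}$$ (all sums over $a,b\in\mathcal{E}$). Then $\sigma$ is a Hopf algebra automorphism and $\sigma^2=D$.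
   Context: $\operatorname{Spec}(D)$ is the set of eigenvalues of $D$. For $0\le k\le m-1$ with $k\notin\mathcal{E}$ one sets $V_{+,k}=V_{-,k}=\{0\}$. For subspaces $U,W$ of $H$, $UW$ denotes the linear span of the products $uw$, $u\in U$, $w\in W$. Note that $q$ has order $m$ and $H=\bigoplus_{i\in\mathcal{E}}E_{D,q^i}$, so $\sigma$ is well defined. *)

(* Defs.v *)
From HB Require Import structures.
From mathcomp Require Import all_boot all_order all_algebra all_field.

Set Implicit Arguments.
Unset Strict Implicit.
Unset Printing Implicit Defensive.

Import GRing.Theory.
Local Open Scope ring_scope.

(* MathComp has no tensor product of vector spaces.  We model U (x) V by the  *)
(* matrices of coordinates with respect to the products of the basis vectors  *)
(* of vbasis {:U} and vbasis {:V}.  The universal property is given below by  *)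
(* tlift_tprod (existence) and tlift_uniq (uniqueness), so nothing depends on *)
(* the choice of the bases.  Since tensor U V is again a vectType, it can be  *)
(* iterated.                                                                  *)
Section Tensor.
Variables (K : fieldType) (U V : vectType K).

Definition tensor := 'M[K]_(\dim {:U}, \dim {:V}).
HB.instance Definition _ := Vector.on tensor.

Definition tprod (u : U) (v : V) : tensor :=
  \matrix_(i, j) (coord (vbasis {:U}) i u * coord (vbasis {:V}) j v).

(* The linear map on U (x) V sending tprod u v to f u v, for f bilinear. *)
Definition tlift (W : lmodType K) (f : U -> V -> W) (t : tensor) : W :=
  \sum_i \sum_j t i j *: f (vbasis {:U})`_i (vbasis {:V})`_j.

(* The subspace A (x) B of U (x) V. *)
Definition tensorv (A : {vspace U}) (B : {vspace V}) : {vspace tensor} :=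
  <<allpairs tprod (vbasis A) (vbasis B)>>%VS.

Lemma tprod_linearl v : linear (tprod^~ v).
Proof.
by move=> a x y; apply/matrixP=> i j; rewrite !mxE linearP mulrDl mulrA.
Qed.

Lemma tprod_linearr u : linear (tprod u).
Proof.
by move=> a x y; apply/matrixP=> i j; rewrite !mxE linearP mulrDr mulrCA.
Qed.

Fact tlift_is_linear (W : lmodType K) (f : U -> V -> W) : linear (tlift f).
Proof.
move=> a s t; rewrite /tlift scaler_sumr -big_split; apply: eq_bigr => i _ /=.
rewrite scaler_sumr -big_split; apply: eq_bigr => j _ /=.
by rewrite !mxE scalerDl scalerA.
Qed.
HB.instance Definition _ (W : lmodType K) (f : U -> V -> W) :=
  GRing.isLinear.Build K tensor W _ (tlift f) (tlift_is_linear f).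

Lemma tensor_expand (t : tensor) :
  t = \sum_i \sum_j t i j *: tprod (vbasis {:U})`_i (vbasis {:V})`_j.
Proof.
apply/matrixP=> k l.
have freeU := basis_free (vbasisP {:U}); have freeV := basis_free (vbasisP {:V}).
rewrite summxE (bigD1 k) //= summxE (bigD1 l) //= !mxE !coord_free // !eqxx.
rewrite !mulr1 [X in t k l + X]big1 ?addr0 => [|j /negPf jl]; last first.
  by rewrite !mxE !coord_free // eqxx jl !mulr0.
rewrite big1 ?addr0 // => i /negPf ik; rewrite summxE big1 // => j _.
by rewrite !mxE !coord_free // ik mul0r mulr0.
Qed.

Lemma tlift_tprod (W : lmodType K) (f : U -> V -> W) :
    (forall v, linear (f^~ v)) -> (forall u, linear (f u)) ->
  forall u v, tlift f (tprod u v) = f u v.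
Proof.
move=> fl fr u v.
pose Fl v0 : {linear U -> W} :=
  HB.pack (f^~ v0) (GRing.isLinear.Build K U W _ (f^~ v0) (fl v0)).
pose Fr u0 : {linear V -> W} :=
  HB.pack (f u0) (GRing.isLinear.Build K V W _ (f u0) (fr u0)).
rewrite -[RHS]/(Fl v u) [in RHS](coord_vbasis (memvf u)) linear_sum.
apply: eq_bigr => i _; rewrite linearZ /=.
rewrite -[f _ v]/(Fr (vbasis {:U})`_i v) [in RHS](coord_vbasis (memvf v)).
rewrite linear_sum scaler_sumr; apply: eq_bigr => j _.
by rewrite linearZ /= mxE scalerA.
Qed.

Lemma tlift_uniq (W : lmodType K) (f : U -> V -> W) (g : {linear tensor -> W}) :
  (forall u v, g (tprod u v) = f u v) -> g =1 tlift f.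
Proof.
move=> gf t; rewrite [t in LHS]tensor_expand linear_sum.
apply: eq_bigr => i _; rewrite linear_sum; apply: eq_bigr => j _.
by rewrite linearZ /= gf.
Qed.

Lemma memv_tprod (A : {vspace U}) (B : {vspace V}) :
  {in A & B, forall u v, tprod u v \in tensorv A B}.
Proof.
move=> u v uA vB; rewrite (coord_vbasis uA) (coord_vbasis vB).
pose Fl v0 : {linear U -> tensor} :=
  HB.pack (tprod^~ v0) (GRing.isLinear.Build K U tensor _ _ (tprod_linearl v0)).
pose Fr u0 : {linear V -> tensor} :=
  HB.pack (tprod u0) (GRing.isLinear.Build K V tensor _ _ (tprod_linearr u0)).
set w := (X in tprod _ X).
rewrite -[tprod _ _]/(Fl w _) linear_sum; apply: memv_suml => i _.
rewrite linearZ memvZ //= -[tprod _ _]/(Fr _ w) linear_sum.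
apply: memv_suml => j _; rewrite linearZ memvZ //= memv_span //.
by apply: allpairs_f; rewrite mem_nth ?size_tuple.
Qed.

Lemma tensorvP (A : {vspace U}) (B : {vspace V}) (C : {vspace tensor}) :
  reflect {in A & B, forall u v, tprod u v \in C} (tensorv A B <= C)%VS.
Proof.
apply: (iffP idP) => [sC u v uA vB|sC]; first exact: subvP sC _ (memv_tprod uA vB).
apply/span_subvP => _ /allpairsP[[u v] /= [uA vB ->]].
by rewrite sC ?vbasis_mem.
Qed.

End Tensor.

Definition tmap (K : fieldType) (U V U' V' : vectType K)
    (f : U -> U') (g : V -> V') : tensor U V -> tensor U' V' :=
  tlift (fun u v => tprod (f u) (g v)).

(* The canonical isomorphism (U (x) V) (x) W -> U (x) (V (x) W). *)
Definition tassoc (K : fieldType) (U V W : vectType K) :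
    tensor (tensor U V) W -> tensor U (tensor V W) :=
  tlift (fun t w => tlift (fun u v => tprod u (tprod v w)) t).

(* The product of the algebra A (x) A: (a (x) b)(c (x) d) = ac (x) bd.  This  *)
(* is not the matrix product of the underlying coordinate matrices.           *)
Definition tmul (K : fieldType) (A : falgType K) (s t : tensor A A) :
    tensor A A :=
  tlift (fun a b => tlift (fun c d => tprod (a * c) (b * d)) t) s.

Lemma tmap_tprod (K : fieldType) (U V U' V' : vectType K)
    (f : {linear U -> U'}) (g : {linear V -> V'}) u v :
  tmap f g (tprod u v) = tprod (f u) (g v).
Proof.
apply: (tlift_tprod (f := fun u v => tprod (f u) (g v))) => w a x y.
  by rewrite linearP tprod_linearl.
by rewrite linearP tprod_linearr.
Qed.

Lemma tassoc_tprod (K : fieldType) (U V W : vectType K) (u : U) (v : V) (w : W) :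
  tassoc (tprod (tprod u v) w) = tprod u (tprod v w).
Proof.
have bl (w0 : W) (u0 : U) (v0 : V) :
    tlift (fun u v => tprod u (tprod v w0)) (tprod u0 v0)
    = tprod u0 (tprod v0 w0).
  apply: (tlift_tprod (f := fun u v => tprod u (tprod v w0))) => z a x y.
    by rewrite tprod_linearl.
  by rewrite tprod_linearl tprod_linearr.
rewrite /tassoc tlift_tprod ?bl // => [w0|t] a x y; first by rewrite linearP.
rewrite /tlift scaler_sumr -big_split; apply: eq_bigr => i _ /=.
rewrite scaler_sumr -big_split; apply: eq_bigr => j _ /=.
by rewrite !tprod_linearr scalerDr !scalerA [t i j * a]mulrC.
Qed.

Lemma tmul_tprod (K : fieldType) (A : falgType K) (a b c d : A) :
  tmul (tprod a b) (tprod c d) = tprod (a * c) (b * d).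
Proof.
rewrite /tmul tlift_tprod.
- apply: (tlift_tprod (f := fun c d => tprod (a * c) (b * d))) => z k x y.
    by rewrite mulrDr -scalerAr tprod_linearl.
  by rewrite mulrDr -scalerAr tprod_linearr.
- move=> z k x y; rewrite /tlift scaler_sumr -big_split.
  apply: eq_bigr => i _ /=; rewrite scaler_sumr -big_split.
  apply: eq_bigr => j _ /=.
  by rewrite mulrDl -scalerAl tprod_linearl scalerDr !scalerA mulrC.
- move=> z k x y; rewrite /tlift scaler_sumr -big_split.
  apply: eq_bigr => i _ /=; rewrite scaler_sumr -big_split.
  apply: eq_bigr => j _ /=.
  by rewrite mulrDl -scalerAl tprod_linearr scalerDr !scalerA mulrC.
Qed.

HB.mixin Record Falgebra_isHopf (K : fieldType) H of Falgebra K H := {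
  comul : 'Hom(H, tensor H H);
  counit : 'Hom(H, K^o);
  antipode : 'End(H);
  comulA : forall x : H,
    tassoc (tmap comul id (comul x)) = tmap id comul (comul x);
  counitl : forall x : H, tlift (fun a b : H => counit a *: b) (comul x) = x;
  counitr : forall x : H, tlift (fun a b : H => counit b *: a) (comul x) = x;
  comul1 : comul 1 = tprod (1 : H) (1 : H);
  comulM : forall x y : H, comul (x * y) = tmul (comul x) (comul y);
  counit1 : counit 1 = 1;
  counitM : forall x y : H, counit (x * y) = counit x * counit y;
  antipodel : forall x : H,
    tlift (fun a b : H => antipode a * b) (comul x) = counit x *: 1;
  antipoder : forall x : H,
    tlift (fun a b : H => a * antipode b) (comul x) = counit x *: 1
}.

#[short(type="hopfAlgType")]
HB.structure Definition HopfAlgebra (K : fieldType) :=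
  { H of Falgebra_isHopf K H & Falgebra K H }.

Section HopfAutomorphism.
Variables (K : fieldType) (H : hopfAlgType K).

(* Compatibility with the antipode follows from the other conditions. *)
Record hopf_automorphism (f : 'End(H)) : Prop := HopfAutomorphism {
  hopf_aut_bij : bijective f;
  hopf_aut1 : f 1 = 1;
  hopf_autM : forall x y, f (x * y) = f x * f y;
  hopf_aut_comul : forall x, comul (f x) = tmap f f (comul x);
  hopf_aut_counit : forall x, counit (f x) = counit x;
  hopf_aut_antipode : forall x, f (antipode x) = antipode (f x)
}.

Definition has_order (f : 'End(H)) (m : nat) : Prop :=
  [/\ (0 < m)%N, iter m f =1 id
    & forall k, (0 < k < m)%N -> ~ iter k f =1 id].

End HopfAutomorphism.

(* Main.v *)
Require Import Defs.
From HB Require Import structures.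
From mathcomp Require Import all_boot all_order all_algebra all_field.

Set Implicit Arguments.
Unset Strict Implicit.
Unset Printing Implicit Defensive.

Import GRing.Theory passmx.
Local Open Scope ring_scope.

(** The map [sigma] acts on each piece [Vp i], [Vm i] by a scalar, and these
    pieces span H: the automorphism [D] has finite order [m], and [q] is a
    primitive [m]-th root of unity, so the averages of the iterates of [D]
    against powers of [q] project onto the eigenspaces of [D]
    ([finite_order_eigen_sum]).  Two linear maps that agree on the pieces are
    therefore equal, and every condition on [sigma] can be tested on vectors
    on which [sigma] is a scalar ([hopf_automorphism_of_eigen_sum]).

    Attach to a piece of sign [e] and degree [i] the scalar
    [wt e i = (-1)^e r^i].  Since [r^m] is -1 for [m] even and 1 for [m] odd,
    lowering a degree by [m] flips the sign exactly when [m] is even.  This is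
    the rule built into the conditions on the product and the comultiplication.
    Hence the product of two pieces lies in the eigenspace of [sigma] for the
    product of the two scalars, and the comultiplication sends a piece of
    scalar [c] into the eigenspace for [c] of the tensor square of [sigma].
    The counit is handled in two ways: on pieces of positive degree it vanishes
    because [D] preserves it and [q^i <> 1], and in degree 0 it kills [Vm 0] by
    hypothesis, while [sigma] is the identity on [Vp 0].
    Finally [wt e i ^ 2 = q^i] gives [sigma^2 = D], which makes [sigma]
    bijective.

    Compatibility with the antipode is automatic for a bialgebra map [s]: the
    composites of [s] with the antipode on either side are both inverse to [s]
    for the convolution product, which is associative
    ([bialgebra_map_antipode]). *)

(** * Convolution and the antipode *)

(** Pure tensors span, so a linear map on a tensor product is determined by
    its values on them. *)
Lemma tensor_ext (K : fieldType) (U V : vectType K) (W : lmodType K)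
    (f g : tensor U V -> W) :
  linear f -> linear g -> (forall u v, f (tprod u v) = g (tprod u v)) -> f =1 g.
Proof.
move=> lf lg fg t.
pose F : {linear tensor U V -> W} :=
  HB.pack f (GRing.isLinear.Build K (tensor U V) W _ f lf).
pose G : {linear tensor U V -> W} :=
  HB.pack g (GRing.isLinear.Build K (tensor U V) W _ g lg).
rewrite -[f t]/(F t) -[g t]/(G t).
have FE := tlift_uniq (f := fun u v => G (tprod u v)) (g := F) fg.
by rewrite FE; apply/esym/tlift_uniq.
Qed.

Section Convolution.
Variables (K : fieldType) (H : hopfAlgType K).
Implicit Types f g h : H -> H.

Definition mul_map f g : tensor H H -> H := tlift (fun a b => f a * g b).

Definition conv f g (x : H) : H := mul_map f g (comul x).

Lemma mul_map_linear f g : linear (mul_map f g).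
Proof. exact: tlift_is_linear. Qed.

Lemma mul_map_tprod f g u v :
  linear f -> linear g -> mul_map f g (tprod u v) = f u * g v.
Proof.
move=> lf lg; apply: (tlift_tprod (f := fun a b => f a * g b)) => w a x y.
  by rewrite lf mulrDl -scalerAl.
by rewrite lg mulrDr -scalerAr.
Qed.

Lemma conv_linear f g : linear (conv f g).
Proof. by move=> a x y; rewrite /conv linearP mul_map_linear. Qed.

(** Both sides are the image of one element of H (x) (H (x) H) under
    u (x) v (x) w |-> f u * g v * h w; coassociativity identifies the two ways
    of producing that element from x. *)
Lemma convA f g h : linear f -> linear g -> linear h ->
  conv f (conv g h) =1 conv (conv f g) h.
Proof.
move=> lf lg lh x.
pose F : tensor H (tensor H H) -> H := tlift (fun u s => f u * mul_map g h s).
have lF : linear F by apply: tlift_is_linear.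
have FE u s : F (tprod u s) = f u * mul_map g h s.
  apply: (tlift_tprod (f := fun u s => f u * mul_map g h s)) => w a y z.
    by rewrite lf mulrDl -scalerAl.
  by rewrite mul_map_linear mulrDr -scalerAr.
have ltm (U V U' V' : vectType K) (k : U -> U') (l : V -> V') :
    linear (tmap k l).
  exact: tlift_is_linear.
have lta : linear (@tassoc K H H H) by apply: tlift_is_linear.
have Fr t : F (tmap idfun comul t) = mul_map f (conv g h) t.
  move: t; apply: tensor_ext => [a y z||u v].
  - by rewrite ltm lF.
  - exact: mul_map_linear.
  by rewrite tmap_tprod FE mul_map_tprod //; apply: conv_linear.
have Fassoc s v : F (tassoc (tprod s v)) = mul_map f g s * h v.
  move: s; apply: tensor_ext => [a y z|a y z|u w].
  - by rewrite tprod_linearl lta lF.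
  - by rewrite mul_map_linear mulrDl -scalerAl.
  by rewrite tassoc_tprod FE !mul_map_tprod // mulrA.
have Fl t : F (tassoc (tmap comul idfun t)) = mul_map (conv f g) h t.
  move: t; apply: tensor_ext => [a y z||u v].
  - by rewrite ltm lta lF.
  - exact: mul_map_linear.
  by rewrite tmap_tprod Fassoc mul_map_tprod //; apply: conv_linear.
by rewrite /conv -/(conv g h) -/(conv f g) -Fr -Fl; congr F; rewrite -comulA.
Qed.

Definition conv_unit (x : H) : H := (counit x : K) *: 1.

Lemma conv1f f : linear f -> conv conv_unit f =1 f.
Proof.
move=> lf x; rewrite -[in RHS](counitl x) /conv; move: (comul x).
have lu : linear conv_unit.
  by move=> a y z; rewrite /conv_unit linearP scalerDl -scalerA.
apply: tensor_ext => [||u v]; first exact: mul_map_linear.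
  by move=> a y z; rewrite linearP lf.
rewrite mul_map_tprod // tlift_tprod => [|v' a y z|u' a y z].
- by rewrite (GRing.scalable_linear lf) -scalerAl mul1r.
- by rewrite linearP scalerDl -scalerA.
- by rewrite scalerDr !scalerA mulrC.
Qed.

Lemma convf1 f : linear f -> conv f conv_unit =1 f.
Proof.
move=> lf x; rewrite -[in RHS](counitr x) /conv; move: (comul x).
have lu : linear conv_unit.
  by move=> a y z; rewrite /conv_unit linearP scalerDl -scalerA.
apply: tensor_ext => [||u v]; first exact: mul_map_linear.
  by move=> a y z; rewrite linearP lf.
rewrite mul_map_tprod // tlift_tprod => [|v' a y z|u' a y z].
- by rewrite (GRing.scalable_linear lf) -scalerAr mulr1.
- by rewrite scalerDr !scalerA mulrC.
- by rewrite linearP scalerDl -scalerA.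
Qed.

Lemma eq_conv f f' g g' : f =1 f' -> g =1 g' -> conv f g =1 conv f' g'.
Proof.
move=> ff gg x; apply: eq_bigr => i _; apply: eq_bigr => j _.
by rewrite ff gg.
Qed.

(** In a monoid, a left inverse and a right inverse of the same element
    coincide. *)
Lemma conv_inverse_unique f g h : linear f -> linear g -> linear h ->
  conv g f =1 conv_unit -> conv f h =1 conv_unit -> g =1 h.
Proof.
move=> lf lg lh gf fh x.
rewrite -(convf1 lg) -(conv1f lh) -(eq_conv (frefl g) fh).
by rewrite -(eq_conv gf (frefl h)) convA.
Qed.

(** Both composites of s with the antipode are convolution inverses of s: on
    one side because s is multiplicative, on the other because it commutes with
    the comultiplication. *)
Lemma bialgebra_map_antipode (s : 'End(H)) :
    s 1 = 1 -> (forall x y, s (x * y) = s x * s y) ->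
    (forall x, comul (s x) = tmap s s (comul x)) ->
    (forall x, counit (s x) = counit x) ->
  forall x, s (antipode x) = antipode (s x).
Proof.
move=> s1 sM s_comul s_counit.
apply: (@conv_inverse_unique s (s \o antipode) (antipode \o s))
  => [a x y|a x y|a x y|x|x].
- exact: linearP.
- by rewrite /= !linearP.
- by rewrite /= !linearP.
- rewrite /conv_unit -[in RHS]s1 -linearZ -antipodel /conv.
  move: (comul x); apply: tensor_ext => [||u v]; first exact: mul_map_linear.
    by move=> a y z; rewrite !linearP.
  rewrite mul_map_tprod ?tlift_tprod /= ?sM //; try exact: linearP.
    by move=> w a y z; rewrite linearP mulrDl -scalerAl.
  by move=> w a y z; rewrite mulrDr -scalerAr.
- rewrite /conv_unit -s_counit -antipoder s_comul /conv.
  move: (comul x); apply: tensor_ext => [||u v]; first exact: mul_map_linear.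
    by move=> a y z; rewrite /tmap !linearP.
  rewrite tmap_tprod mul_map_tprod ?tlift_tprod //; try exact: linearP.
    by move=> w a y z; rewrite mulrDl -scalerAl.
  by move=> w a y z; rewrite linearP mulrDr -scalerAr.
Qed.
End Convolution.

(** * Eigenspaces *)

Lemma leigenspaceP (K : fieldType) (V : vectType K) (f : 'End(V)) c x :
  reflect (f x = c *: x) (x \in leigenspace f c).
Proof. by rewrite memv_ker !lfun_simp subr_eq0; apply: eqP. Qed.

Lemma sumv_ext (K : fieldType) (U : vectType K) (W : lmodType K) (I : finType)
    (V : I -> {vspace U}) (f g : U -> W) :
  linear f -> linear g -> (\sum_i V i = fullv)%VS ->
  (forall i, {in V i, f =1 g}) -> f =1 g.
Proof.
move=> lf lg Vfull fg x.
pose F : {linear U -> W} := HB.pack f (GRing.isLinear.Build K U W _ f lf).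
pose G : {linear U -> W} := HB.pack g (GRing.isLinear.Build K U W _ g lg).
have /memv_sumP[v vV ->]: x \in (\sum_i V i)%VS by rewrite Vfull memvf.
rewrite -[f _]/(F _) -[g _]/(G _) !linear_sum.
by apply: eq_bigr => i _; apply: fg; apply: vV.
Qed.

(** The component of x in the eigenspace for z^i is the average over k < n of
    z^(-ik) f^k(x). *)
Lemma finite_order_eigen_sum (K : fieldType) (V : vectType K) (f : 'End(V))
    (n : nat) (z : K) :
  n.-primitive_root z -> iter n f =1 id ->
  (\sum_(i < n) leigenspace f (z ^+ i))%VS = fullv.
Proof.
move=> z_prim fn; have n_gt0 := prim_order_gt0 z_prim.
have zn := prim_expr_order z_prim.
have z0 : z != 0.
  by rewrite -unitfE; apply/unitrPr; exists (z ^+ n.-1); rewrite -exprS prednK.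
apply/eqP; rewrite eqEsubv subvf /=; apply/subvP => x _.
pose p (i : 'I_n) := n%:R^-1 *: \sum_(k < n) (z ^- (i * k)) *: iter k f x.
have nK0 : n%:R != 0 :> K := prim_root_natf_neq0 z_prim.
have -> : x = \sum_i p i.
  (* Summing the components over i leaves only the term k = 0: for the others
     the powers of the root of unity z^(-k) <> 1 add up to 0. *)
  rewrite -scaler_sumr exchange_big /= (bigD1 (Ordinal n_gt0)) //=.
  under eq_bigr do rewrite muln0 expr0 invr1 scale1r.
  rewrite sumr_const card_ord big1 ?addr0.
    by rewrite -scaler_nat scalerA mulVf // scale1r.
  move=> k k0; rewrite -scaler_suml.
  under eq_bigr do rewrite mulnC exprM -exprVn.
  suff -> : \sum_(i < n) (z ^+ k)^-1 ^+ i = 0 by rewrite scale0r.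
  have /eqP := subrX1 (z ^+ k)^-1 n.
  rewrite exprVn -exprM mulnC exprM zn expr1n invr1 subrr eq_sym mulf_eq0.
  case/orP=> /eqP // /eqP; rewrite subr_eq0 invr_eq1 -(prim_order_dvd z_prim).
  by rewrite gtnNdvd // lt0n.
apply: memv_sumr => i _; apply/leigenspaceP.
rewrite /p linearZ scalerA mulrC -scalerA linear_sum; congr (_ *: _).
pose u k := z ^- (i * k) *: iter k f x.
have uS k : f (u k) = z ^+ i *: u k.+1.
  rewrite /u linearZ scalerA /= mulnS exprD invfM mulrA mulfV ?mul1r //.
  exact: expf_neq0.
have un : u n = u 0%N.
  by rewrite /u fn mulnC exprM zn expr1n muln0 expr0.
transitivity (\sum_(k < n) z ^+ i *: u k.+1).
  by apply: eq_bigr => k _; apply: uS.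
rewrite -scaler_sumr; congr (_ *: _).
(* u is n-periodic, so shifting the summation index changes nothing. *)
apply: (addrI (u 0%N)); rewrite -{2}un [RHS]addrC.
by rewrite -(big_ord_recl n (fun k : 'I_n.+1 => u k)) big_ord_recr.
Qed.

HB.instance Definition _ (K : fieldType) (U V U' V' : vectType K)
    (f : U -> U') (g : V -> V') :=
  GRing.isLinear.Build K (tensor U V) (tensor U' V') _ (tmap f g)
    (@tlift_is_linear K U V _ (fun u v => tprod (f u) (g v))).

Lemma tensorv_leigenspace (K : fieldType) (U V : vectType K)
    (f : 'End(U)) (g : 'End(V)) (a b : K) (A : {vspace U}) (B : {vspace V}) :
  (A <= leigenspace f a)%VS -> (B <= leigenspace g b)%VS ->
  (tensorv A B <= leigenspace (linfun (tmap f g)) (a * b))%VS.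
Proof.
move=> Aa Bb; apply/tensorvP=> u v uA vB; apply/leigenspaceP.
rewrite lfunE /= tmap_tprod /=.
have /leigenspaceP-> := subvP Aa u uA; have /leigenspaceP-> := subvP Bb v vB.
rewrite (GRing.scalable_linear (tprod_linearl _)).
rewrite (GRing.scalable_linear (tprod_linearr _)); exact: scalerA.
Qed.

(** * Square roots of automorphisms *)

(** Preservation of the product, the comultiplication and the counit is linear
    in each argument, and on the pieces V i it compares two scalar multiples of
    one vector. *)
Lemma hopf_automorphism_of_eigen_sum (K : fieldType) (H : hopfAlgType K)
    (s : 'End(H)) (I : finType) (V : I -> {vspace H}) (c : I -> K) :
    bijective s -> (\sum_i V i)%VS = fullv ->
    (forall i, V i <= leigenspace s (c i))%VS ->
    s 1 = 1 ->
    (forall i j, V i * V j <= leigenspace s (c i * c j))%VS ->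
    (forall i, {in V i, forall x, c i * counit x = counit x}) ->
    (forall i, comul @: V i <= leigenspace (linfun (tmap s s)) (c i))%VS ->
  hopf_automorphism s.
Proof.
move=> s_bij Vfull sV s1 VM Veps Vcomul.
have sE i x : x \in V i -> s x = c i *: x.
  by move=> xV; apply/leigenspaceP; apply: (subvP (sV i)).
have sM x y : s (x * y) = s x * s y.
  move: x; apply: (sumv_ext _ _ Vfull) => [a x z|a x z|i x xV].
  - by rewrite mulrDl -scalerAl linearP.
  - by rewrite linearP mulrDl -scalerAl.
  move: y; apply: (sumv_ext _ _ Vfull) => [a y z|a y z|j y yV].
  - by rewrite mulrDr -scalerAr linearP.
  - by rewrite linearP mulrDr -scalerAr.
  rewrite (sE _ _ xV) (sE _ _ yV) -scalerAl -scalerAr scalerA.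
  by apply/leigenspaceP; apply: (subvP (VM i j)); apply: memv_mul.
have s_comul x : comul (s x) = tmap s s (comul x).
  move: x; apply: (sumv_ext _ _ Vfull) => [a x z|a x z|i x xV].
  - by rewrite !linearP.
  - by rewrite !linearP.
  rewrite (sE _ _ xV) linearZ; apply/esym.
  have /leigenspaceP := subvP (Vcomul i) _ (memv_img comul xV).
  by rewrite lfunE.
have s_counit x : counit (s x) = counit x.
  move: x; apply: (sumv_ext _ _ Vfull) => [a x z|a x z|i x xV].
  - by rewrite !linearP.
  - by rewrite !linearP.
  by rewrite (sE _ _ xV) linearZ; apply: Veps.
by split=> //; apply: bialgebra_map_antipode.
Qed.

Theorem corollary5p4 (K : closedFieldType) (charK0 : [pchar K] =i pred0)
    (H : hopfAlgType K) (D : 'End(H)) (m : nat) (r : K)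
    (Vp Vm : nat -> {vspace H}) (sigma : 'End(H)) :
  let q := r ^+ 2 in
  let E (i : nat) := (i < m)%N && leigenvalue D (q ^+ i) in
  let P (a b : nat) := (tensorv (Vp a) (Vp b) + tensorv (Vm a) (Vm b))%VS in
  let N (a b : nat) := (tensorv (Vp a) (Vm b) + tensorv (Vm a) (Vp b))%VS in
  let S (F : nat -> nat -> {vspace tensor H H}) (n : nat) :=
    (\sum_(a < m | E a) \sum_(b < m | (E b) && (a + b == n)%N)
       F a b)%VS in
  hopf_automorphism D ->
  has_order D m ->
  (if odd m then m else m.*2).-primitive_root r ->
  (forall i, E i ->
    leigenspace D (q ^+ i) = (Vp i + Vm i)%VS /\ directv (Vp i + Vm i)) ->
  (forall i, (i < m)%N -> ~~ E i -> Vp i = 0%VS /\ Vm i = 0%VS) ->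
  (forall i, E i ->
    {in Vp i, forall x, sigma x = r ^+ i *: x} /\
    {in Vm i, forall x, sigma x = - (r ^+ i) *: x}) ->
  (* (A1) *)
  1 \in Vp 0%N ->
  (* (A2) *)
  (forall i j, E i -> E j -> (i + j <= m.-1)%N ->
    (Vp i * Vp j + Vm i * Vm j <= Vp (i + j)%N)%VS /\
    (Vp i * Vm j + Vm i * Vp j <= Vm (i + j)%N)%VS) ->
  (* (A3) *)
  (forall i j, E i -> E j -> (m <= i + j <= m.*2 - 2)%N ->
    (~~ odd m ->
      (Vp i * Vp j + Vm i * Vm j <= Vm (i + j - m)%N)%VS /\
      (Vp i * Vm j + Vm i * Vp j <= Vp (i + j - m)%N)%VS) /\
    (odd m ->
      (Vp i * Vp j + Vm i * Vm j <= Vp (i + j - m)%N)%VS /\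
      (Vp i * Vm j + Vm i * Vp j <= Vm (i + j - m)%N)%VS)) ->
  (* (C1) *)
  (counit @: Vm 0%N = 0)%VS ->
  (* (C2) *)
  (forall i, E i ->
    (~~ odd m ->
      (comul @: Vp i <= S P i + S N (i + m)%N)%VS /\
      (comul @: Vm i <= S N i + S P (i + m)%N)%VS) /\
    (odd m ->
      (comul @: Vp i <= S P i + S P (i + m)%N)%VS /\
      (comul @: Vm i <= S N i + S N (i + m)%N)%VS)) ->
  hopf_automorphism sigma /\ (sigma \o sigma)%VF = D.
Proof.
move=> q E P N S D_aut [m_gt0 Dm _] r_prim E_split E0 sigmaE A1 A2 A3 C1 C2.
have r_m : r ^+ m = (-1) ^+ ~~ odd m.
  move: r_prim; case: ifP => m_odd r_prim; first exact: prim_expr_order.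
  have /eqP : (r ^+ m) ^+ 2 = 1 by rewrite -exprM muln2 prim_expr_order.
  rewrite sqrf_eq1 -(prim_order_dvd r_prim) => /orP[|/eqP //].
  by rewrite gtnNdvd // -addnn -[ltnLHS]addn0 ltn_add2l.
have q_prim : m.-primitive_root q.
  move: r_prim; case: ifP => m_odd r_prim.
    by rewrite prim_root_exp_coprime // coprime2n.
  rewrite -[m](mulKn _ (isT : 0 < 2)%N).
  have := exp_prim_root r_prim 2.
  by rewrite -muln2 gcdnMl mulnC.
(* A sign is encoded as a boolean, true standing for minus, so that signs
   multiply by exclusive or. *)
pose W (e : bool) i := if e then Vm i else Vp i.
pose wt (e : bool) i : K := (-1) ^+ e * r ^+ i.
have WE e i : (i < m)%N -> W e i != 0%VS -> E i.
  move=> i_lt; apply: contraNT => /(E0 i i_lt)[Vp0 Vm0].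
  by rewrite /W Vp0 Vm0; case: e.
have W_sigma e i : (i < m)%N -> (W e i <= leigenspace sigma (wt e i))%VS.
  move=> i_lt; have [->|/WE-/(_ i_lt) Ei] := eqVneq (W e i) 0%VS.
    exact: sub0v.
  have [sp sm] := sigmaE i Ei.
  apply/subvP => x; rewrite /W /wt; case: e => xW; apply/leigenspaceP.
    by rewrite sm // mulN1r.
  by rewrite sp // mul1r.
have W_D e i : (i < m)%N -> (W e i <= leigenspace D (q ^+ i))%VS.
  move=> i_lt; have [->|/WE-/(_ i_lt) Ei] := eqVneq (W e i) 0%VS.
    exact: sub0v.
  by rewrite (E_split i Ei).1 /W; case: e; rewrite ?addvSl ?addvSr.
have W_full : (\sum_(k : bool * 'I_m) W k.1 k.2)%VS = fullv.
  apply/eqP; rewrite eqEsubv subvf -(finite_order_eigen_sum q_prim Dm) /=.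
  apply/subv_sumP => i _.
  have [Ei|] := boolP (E i); last first.
    by rewrite /E ltn_ord negbK => /eqP->; apply: sub0v.
  rewrite (E_split i Ei).1 subv_add.
  by rewrite (sumv_sup (false, i)) ?(sumv_sup (true, i)).
have wtD e f i j : wt e i * wt f j = wt (e (+) f) (i + j)%N.
  by rewrite /wt mulrACA -signr_addb exprD.
have wt_m e i : wt e (i + m)%N = wt (e (+) ~~ odd m) i.
  by rewrite /wt exprD r_m signr_addb mulrA mulrAC.
have W_mul e f i j : (i < m)%N -> (j < m)%N ->
    (W e i * W f j <= leigenspace sigma (wt e i * wt f j))%VS.
  move=> i_lt j_lt.
  have [->|/WE-/(_ i_lt) Ei] := eqVneq (W e i) 0%VS.
    by rewrite prod0v sub0v.
  have [->|/WE-/(_ j_lt) Ej] := eqVneq (W f j) 0%VS.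
    by rewrite prodv0 sub0v.
  rewrite wtD; have [lt_m|le_m] := ltnP (i + j) m.
    apply: subv_trans (W_sigma _ _ lt_m).
    have := A2 i j Ei Ej; rewrite -ltnS prednK // => /(_ lt_m).
    rewrite !subv_add /W => -[/andP[? ?] /andP[? ?]].
    by case: e; case: f.
  have lt_m : (i + j - m < m)%N by rewrite ltn_subLR // -addSn leq_add // ltnW.
  rewrite -(subnK le_m) wt_m; apply: subv_trans (W_sigma _ _ lt_m).
  have [] := A3 i j Ei Ej.
    rewrite le_m -(prednK m_gt0) doubleS subn2 -addnn.
    by rewrite leq_add // -ltnS prednK.
  rewrite !subv_add /W.
  case: (odd m) => [_ /(_ isT) Wij|/(_ isT) Wij _];
    case: Wij => [/andP[? ?] /andP[? ?]]; by case: e; case: f.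
pose T : 'End(tensor H H) := linfun (tmap sigma sigma).
have W_tens e f i j : (i < m)%N -> (j < m)%N ->
    (tensorv (W e i) (W f j) <= leigenspace T (wt (e (+) f) (i + j)%N))%VS.
  by move=> i_lt j_lt; rewrite -wtD; apply: tensorv_leigenspace; apply: W_sigma.
have S_sub F e n :
    (forall a b, (a < m)%N -> (b < m)%N ->
      (F a b <= leigenspace T (wt e (a + b)%N))%VS) ->
    (S F n <= leigenspace T (wt e n))%VS.
  move=> FT; apply/subv_sumP => a _; apply/subv_sumP => b /andP[_ /eqP <-].
  exact: FT.
have SP n : (S P n <= leigenspace T (wt false n))%VS.
  apply: S_sub => a b a_lt b_lt; rewrite subv_add.
  by rewrite (W_tens false false) ?(W_tens true true).
have SN n : (S N n <= leigenspace T (wt true n))%VS.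
  apply: S_sub => a b a_lt b_lt; rewrite subv_add.
  by rewrite (W_tens false true) ?(W_tens true false).
have W_comul e i : (i < m)%N -> (comul @: W e i <= leigenspace T (wt e i))%VS.
  move=> i_lt; have [->|/WE-/(_ i_lt) Ei] := eqVneq (W e i) 0%VS.
    by rewrite limg0 sub0v.
  have [] := C2 i Ei; rewrite /W.
  have SPm := SP (i + m)%N; have SNm := SN (i + m)%N.
  rewrite !wt_m in SPm SNm.
  case: (odd m) SPm SNm => SPm SNm => [_ /(_ isT) Wi|/(_ isT) Wi _];
    case: Wi => Wpi Wmi; case: e.
  - by apply: (subv_trans Wmi); rewrite subv_add SN; exact: SNm.
  - by apply: (subv_trans Wpi); rewrite subv_add SP; exact: SPm.
  - by apply: (subv_trans Wmi); rewrite subv_add SN; exact: SPm.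
  - by apply: (subv_trans Wpi); rewrite subv_add SP; exact: SNm.
have W_counit e i : (i < m)%N ->
    {in W e i, forall x, wt e i * counit x = counit x}.
  move=> i_lt x xW; have [i0|i_gt0] := posnP i.
    move: xW; rewrite i0 /wt /W; case: e => xW; last by rewrite !mul1r.
    have : counit x \in (counit @: Vm 0%N)%VS by apply: memv_img.
    by rewrite C1 memv0 => /eqP->; rewrite mulr0.
  have : counit (D x) = counit x by apply: hopf_aut_counit D_aut _.
  have /leigenspaceP-> := subvP (W_D e i i_lt) x xW.
  rewrite linearZ => /eqP; rewrite -subr_eq0 -[X in _ - X]mul1r -mulrBl.
  rewrite mulf_eq0 subr_eq0 -(prim_order_dvd q_prim) gtnNdvd //= => /eqP->.
  by rewrite mulr0.
have sigma2 : (sigma \o sigma)%VF = D.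
  apply/lfunP; apply: (sumv_ext _ _ W_full); try exact: linearP.
  move=> [e i] x xW.
  have /leigenspaceP sx := subvP (W_sigma e i (ltn_ord i)) x xW.
  have /leigenspaceP-> := subvP (W_D e i (ltn_ord i)) x xW.
  rewrite lfunE /= sx linearZ /= sx scalerA wtD addbb /wt mul1r.
  by rewrite addnn -mul2n exprM.
have sigma_bij : bijective sigma.
  have sigma_ker : lker sigma == 0%VS.
    apply/lker0P => x y sxy; apply: (bij_inj (hopf_aut_bij D_aut)).
    by rewrite -sigma2 !lfunE /= sxy.
  by exists (sigma^-1)%VF; [apply: lker0_lfunK | apply: lker0_lfunVK].
split; last exact: sigma2.
apply: (@hopf_automorphism_of_eigen_sum K H sigma _
  (fun k : bool * 'I_m => W k.1 k.2) (fun k => wt k.1 k.2) sigma_bij W_full).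
- by move=> [e i]; apply: W_sigma.
- have /leigenspaceP-> := subvP (W_sigma false 0%N m_gt0) _ A1.
  by rewrite /wt mul1r scale1r.
- by move=> [e i] [f j]; apply: W_mul.
- by move=> [e i]; apply: W_counit.
- by move=> [e i]; apply: W_comul.
Qed.
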